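(* Let $(A,d_A)$ and $(H,d_H)$ be chain complexes and let $(p,i,h)$ be a contraction from $A$ to $H$. Suppose $(A,\mu,\alpha,d_A)$ is a differential graded hom-associative algebra such that $\alpha\circ h=h\circ\alpha$. Then $(H,d_H)$ inherits a structure of an $HA_\infty$-algebra; that is, there are maps $\mu_k^H:H^{\otimes k}\to H$ ($k\ge1$) of degree $k-2$ such that $(H,\mu_k^H,\alpha_H)$ is an $HA_\infty$-algebra with $\alpha_H=p\circ\alpha\circ i$, $\mu_1^H=d_H$ and $\mu_2^H(x,y)=p\,\mu(i(x),i(y))$ for $x,y\in H$.
   Context: All vector spaces are over a field of characteristic zero; the Koszul sign rule is used; the given map $\alpha:A\to A$ is assumed not identically zero. Differentials have degree $-1$. Contraction from $(A,d_A)$ to $(H,d_H)$: chain maps $p:A\to H$, $i:H\to A$ and a degree $+1$ linear map $h:A\to A$ with $1_A-i\circ p=d_Ah+hd_A$ and $p\circ i=1_H$. Differential graded hom-associative algebra $(A,\mu,\alpha,d)$: a graded vector space $A$ with a degree $0$ bilinear map $\mu$, a degree $0$ linear map $\alpha$ and a degree $-1$ map $d$ with $d^2=0$, satisfying $\alpha(\mu(a,b))=\mu(\alpha(a),\alpha(b))$, $\mu(\alpha(a),\mu(b,c))=\mu(\mu(a,b),\alpha(c))$, $\alpha\circ d=d\circ\alpha$ and $d\mu(a,b)=\mu(da,b)+(-1)^{|a|}\mu(a,db)$. $HA_\infty$-algebra $(A,\mu_k,\alpha)$: a graded vector space $A$ with linear maps $\mu_k:A^{\otimes k}\to A$ of degree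 $k-2$ ($k\ge1$) and a degree $0$ linear map $\alpha$ with $\alpha\circ\mu_k=\mu_k\circ\alpha^{\otimes k}$, such that for all $n\ge1$ $$\sum_{r+s+t=n,\ r,t\ge0,\ s\ge1}(-1)^{rs+t}\,\mu_{r+1+t}\big((\alpha^{s-1})^{\otimes r}\otimes\mu_s\otimes(\alpha^{s-1})^{\otimes t}\big)=0 .$$ *)

(* Defs.v *)
From mathcomp Require Import all_boot all_order all_algebra.

Set Implicit Arguments.
Unset Strict Implicit.
Unset Printing Implicit Defensive.

Import Order.TTheory GRing.Theory Num.Theory.
Local Open Scope ring_scope.

(* A Z-graded vector space is encoded by its total space, together with the
   homogeneous subspaces of which it is the internal direct sum. *)
Record gvect (F : fieldType) := GVect {
  gcar :> lmodType F;
  gpart : int -> {pred gcar};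
  gpart_submod : forall n, submod_closed (gpart n);
  gpart_span : forall v : gcar, exists (s : seq int) (c : int -> gcar),
    (forall n, c n \in gpart n) /\ v = \sum_(n <- s) c n;
  gpart_indep : forall (s : seq int) (c : int -> gcar), uniq s ->
    (forall n, c n \in gpart n) -> \sum_(n <- s) c n = 0 ->
    forall n, n \in s -> c n = 0
}.
Arguments gpart {F} g n.

Definition has_degree (F : fieldType) (V W : gvect F) (q : int) (f : V -> W) :=
  forall (n : int) (x : V), x \in gpart V n -> f x \in gpart W (n + q).

Record chain_complex (F : fieldType) := ChainComplex {
  cc_vect :> gvect F;
  cc_d : {linear cc_vect -> cc_vect};
  cc_degree : has_degree (-1) cc_d;
  cc_dd : forall x, cc_d (cc_d x) = 0
}.
Arguments cc_d {F} c.

Definition chain_map (F : fieldType) (A B : chain_complex F)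
    (f : {linear A -> B}) :=
  has_degree 0 f /\ (forall x, f (cc_d A x) = cc_d B (f x)).

Definition contraction (F : fieldType) (A H : chain_complex F)
    (p : {linear A -> H}) (i : {linear H -> A}) (h : {linear A -> A}) :=
  [/\ chain_map p, chain_map i, has_degree 1 h,
      forall a, a - i (p a) = cc_d A (h a) + h (cc_d A a)
    & forall x, p (i x) = x].

Definition dg_hom_assoc (F : fieldType) (A : chain_complex F)
    (mu : {bilinear A -> A -> A}) (alpha : {linear A -> A}) :=
  (forall (m n : int) (a b : A), a \in gpart A m -> b \in gpart A n ->
     mu a b \in gpart A (m + n)) /\
  has_degree 0 alpha /\
  (forall a b, alpha (mu a b) = mu (alpha a) (alpha b)) /\
  (forall a b c, mu (alpha a) (mu b c) = mu (mu a b) (alpha c)) /\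
  (forall a, alpha (cc_d A a) = cc_d A (alpha a)) /\
  (forall (n : int) (a b : A), a \in gpart A n ->
     cc_d A (mu a b) = mu (cc_d A a) b + (-1) ^ n *: mu a (cc_d A b)).

(* A linear map out of the k-th tensor power is encoded by the multilinear map
   on k-tuples that it corresponds to. *)
Definition upd_tuple (T : Type) (k : nat) (t : k.-tuple T) (i : 'I_k) (x : T) :
    k.-tuple T :=
  [tuple if j == i then x else tnth t j | j < k].

Definition multilinear (F : fieldType) (V W : lmodType F) (k : nat)
    (f : k.-tuple V -> W) :=
  forall (i : 'I_k) (t : k.-tuple V), linear (fun x => f (upd_tuple t i x)).

Definition multi_degree (F : fieldType) (V W : gvect F) (k : nat) (q : int)
    (f : k.-tuple V -> W) :=
  forall (d : k.-tuple int) (t : k.-tuple V),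
    (forall j, tnth t j \in gpart V (tnth d j)) ->
    f t \in gpart W (\sum_(j < k) tnth d j + q).

Section HAinf.
Variables (F : fieldType) (V : gvect F).
Variables (mu : forall k : nat, k.-tuple V -> V) (alpha : V -> V).

(* The operation whose arity is the length of the list of arguments. *)
Definition mu_seq (s : seq V) : V := mu (in_tuple s).

(* The value of
     mu_(r+1+t) \o ((alpha^(s-1))^(⊗ r) ⊗ mu_s ⊗ (alpha^(s-1))^(⊗ t))
   at a_1 ⊗ ... ⊗ a_n, for homogeneous a_j of degree d_j and n = r + s + t.
   The sign is the Koszul sign for moving mu_s, of degree s - 2, past
   a_1, ..., a_r. *)
Definition ha_comp (r s : nat) (d : seq int) (a : seq V) : V :=
  (-1) ^ ((s%:Z - 2) * \sum_(e <- take r d) e) *: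
    mu_seq (map (iter s.-1 alpha) (take r a)
            ++ mu_seq (take s (drop r a))
            :: map (iter s.-1 alpha) (drop (r + s) a)).

(* mu 0 is not part of the structure: it is unconstrained and unused. *)
Definition is_HAinf : Prop :=
  (forall k, (0 < k)%N -> multilinear (@mu k)) /\
  (forall k, (0 < k)%N -> multi_degree (W := V) (k%:Z - 2) (@mu k)) /\
  linear alpha /\
  has_degree 0 alpha /\
  (forall k (t : k.-tuple V), (0 < k)%N ->
     alpha (mu t) = mu (map_tuple alpha t)) /\
  (forall (n : nat) (d : n.-tuple int) (a : n.-tuple V), (0 < n)%N ->
     (forall j, tnth a j \in gpart V (tnth d j)) ->
     \sum_(r < n.+1) \sum_(s < n.+1)
       \sum_(t < n.+1 | (r + s + t == n)%N && (0 < s)%N)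
         (-1) ^+ (r * s + t) *: ha_comp r s d a = 0).

End HAinf.

(* Main.v *)
(** With [eps x = (-1)^|x| x], passing to the shifted space turns the product
    into [m a b = mu (eps a) b] and the shifted Koszul sign into [- eps], so that
    all identities hold for arbitrary, not only homogeneous, elements. Define on
    words in [H], recursively on the length,
      [phi = i - h lam],   [lam = phi * phi],   [b = d_H + p lam],
    where [*] splits a word in two, applies [m], and compensates the lengths of
    the two halves by powers of [alpha]. Hom-associativity makes [*] associative
    up to sign, and the coderivation extending [b] is a derivation of [*];
    by induction on the length, [d lam = - lam b] and [d phi + lam = phi b].
    Applying [p] to the first identity gives [b b = 0], which is the Stasheff
    relation after undoing the shift. *)

From HB Require Import structures.
From Stdlib Require Import IndefiniteDescription.
Require Import Defs.
From mathcomp Require Import all_boot all_order all_algebra.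
From mathcomp Require Import zify.

Set Implicit Arguments.
Unset Strict Implicit.
Unset Printing Implicit Defensive.

Import Order.TTheory GRing.Theory Num.Theory.
Local Open Scope ring_scope.

(** * Iterates of linear maps and triangular double sums *)

Lemma iter_is_linear (F : fieldType) (V : lmodType F) (f : {linear V -> V}) n :
  linear (iter n f).
Proof. by elim: n => [|n IHn] c x y //=; rewrite IHn linearP. Qed.

HB.instance Definition _ (F : fieldType) (V : lmodType F) (f : {linear V -> V}) n :=
  GRing.isLinear.Build F V V *:%R (iter n f) (iter_is_linear f n).

Lemma iter_morph (U V : Type) (g : U -> V) (f : U -> U) (f' : V -> V) n :
  (forall x, g (f x) = f' (g x)) -> forall x, g (iter n f x) = iter n f' (g x).
Proof. by move=> gf x; elim: n => //= n IHn; rewrite gf IHn. Qed.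

Lemma sum_triangle (V : zmodType) (a b : nat) (G : nat -> nat -> V) :
  \sum_(a <= i < b) \sum_(i <= j < b) G i j =
  \sum_(a <= j < b) \sum_(a <= i < j.+1) G i j.
Proof.
under eq_big_nat => i /andP[ai ib].
  rewrite (big_nat_widenl _ a) //=.
  over.
rewrite (exchange_big_dep_nat xpredT) //=.
apply: eq_big_nat => j /andP[aj jb].
by rewrite [RHS](big_nat_widen _ _ b) //.
Qed.

Lemma sum_triangle_lt (V : zmodType) (a b : nat) (G : nat -> nat -> V) :
  \sum_(a <= i < b) \sum_(i.+1 <= j < b) G i j =
  \sum_(a.+1 <= j < b) \sum_(a <= i < j) G i j.
Proof.
under eq_big_nat => i /andP[ai ib].
  rewrite (big_nat_widenl _ a.+1) //=.
  over.
rewrite (exchange_big_dep_nat xpredT) //=.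
apply: eq_big_nat => j /andP[aj jb].
by rewrite [RHS](big_nat_widen _ _ b) // ltnW.
Qed.

Lemma drop_cat_sub (T : Type) k (s t : seq T) :
  drop k (s ++ t) = drop k s ++ drop (k - size s) t.
Proof.
elim: s k => [|x s IHs] [|k] //=; rewrite ?subn0 //.
by rewrite sub0n drop0.
Qed.

Lemma take_cat_sub (T : Type) k (s t : seq T) :
  take k (s ++ t) = take k s ++ take (k - size s) t.
Proof.
elim: s k => [|x s IHs] [|k] //=; rewrite ?subn0 ?sub0n ?take0 //.
by rewrite IHs subSS.
Qed.

(** * Coderivations on words *)

Section Insertion.
Variables (T : Type) (B : seq T -> T) (sigma al : T -> T).

(* [B] is applied to the entries at positions [r <= j < e]. *)
Definition insert_op (r e : nat) (l : seq T) : seq T :=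
  [seq sigma (iter (e - r.+1) al x) | x <- take r l]
  ++ B (drop r (take e l)) :: [seq iter (e - r.+1) al x | x <- drop e l].

Lemma size_insert_op r e l : (r < e <= size l)%N ->
  size (insert_op r e l) = (size l - (e - r.+1))%N.
Proof.
by move=> re; rewrite size_cat /= !size_map size_takel ?size_drop; lia.
Qed.

Lemma take_insert_op_before k r e l : (k <= r)%N -> (r < e <= size l)%N ->
  take k (insert_op r e l) =
  [seq sigma (iter (e - r.+1) al x) | x <- take k l].
Proof.
move=> kr re; rewrite takel_cat; last by rewrite size_map size_takel; lia.
by rewrite -map_take take_takel.
Qed.

Lemma drop_insert_op_before k r e l : (k <= r)%N -> (r < e <= size l)%N ->
  drop k (insert_op r e l) = insert_op (r - k) (e - k) (drop k l).
Proof.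
move=> kr re; rewrite /insert_op.
rewrite (_ : e - k - (r - k).+1 = e - r.+1)%N; last by lia.
rewrite drop_cat_sub size_map size_takel; last by lia.
rewrite (_ : k - r = 0)%N ?drop0; last by lia.
rewrite -map_drop !take_drop !drop_drop !subnK //; lia.
Qed.

Lemma take_insert_op_after k r e l : (r < e <= k)%N -> (k <= size l)%N ->
  take (k - (e - r.+1)) (insert_op r e l) = insert_op r e (take k l).
Proof.
move=> re kl; rewrite /insert_op take_cat size_map size_takel; last by lia.
rewrite (_ : (_ < r)%N = false); last by lia.
rewrite (_ : k - (e - r.+1) - r = (k - e).+1)%N /=; last by lia.
rewrite -map_take take_drop subnK; last by lia.
by rewrite !take_takel //; lia.
Qed.

Lemma drop_insert_op_after k r e l : (r < e <= k)%N -> (k <= size l)%N ->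
  drop (k - (e - r.+1)) (insert_op r e l) =
  [seq iter (e - r.+1) al x | x <- drop k l].
Proof.
move=> re kl; rewrite /insert_op drop_cat size_map size_takel; last by lia.
rewrite (_ : (_ < r)%N = false); last by lia.
rewrite (_ : k - (e - r.+1) - r = (k - e).+1)%N /=; last by lia.
by rewrite -map_drop drop_drop subnK //; lia.
Qed.

(** This is [f] precomposed with the coderivation of the tensor coalgebra that extends [B], twisted
    by powers of [al]. Keeping [f] in the definition avoids formal sums of words. *)
Definition coder (V : zmodType) (f : seq T -> V) (l : seq T) : V :=
  \sum_(0 <= r < size l) \sum_(r.+1 <= e < (size l).+1) f (insert_op r e l).

End Insertion.

(** * The convolution product of functions on words *)

Section Cup.
Variables (F : fieldType) (A : lmodType F) (T : Type).
Variables (mu : {bilinear A -> A -> A}) (epsA alA : {linear A -> A}).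
Implicit Types (f g q : seq T -> A) (l : seq T).

Definition smu (a b : A) : A := mu (epsA a) b.

(** Both halves are nonempty. Each value is hit by [alA] as often as the other half has letters,
    minus one, so that all terms carry comparable powers of the twisting map. *)
Definition cup f g l : A :=
  \sum_(1 <= k < size l)
    smu (iter (size l - k.+1) alA (f (take k l)))
        (iter k.-1 alA (g (drop k l))).

Lemma smu_suml (I : Type) (r : seq I) (P : pred I) (E : I -> A) b :
  smu (\sum_(j <- r | P j) E j) b = \sum_(j <- r | P j) smu (E j) b.
Proof. by rewrite /smu linear_sum linear_sumlz. Qed.

Lemma smu_sumr (I : Type) (r : seq I) (P : pred I) (E : I -> A) a :
  smu a (\sum_(j <- r | P j) E j) = \sum_(j <- r | P j) smu a (E j).
Proof. by rewrite /smu linear_sumr. Qed.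

Lemma eq_cup f f' g g' l :
  (forall k, (0 < k < size l)%N -> f (take k l) = f' (take k l)) ->
  (forall k, (0 < k < size l)%N -> g (drop k l) = g' (drop k l)) ->
  cup f g l = cup f' g' l.
Proof. by move=> ff gg; apply: eq_big_nat => k kl; rewrite ff ?gg. Qed.

Lemma cupDl f f' g l : cup (fun x => f x + f' x) g l = cup f g l + cup f' g l.
Proof.
by rewrite -big_split /=; apply: eq_bigr => k _; rewrite /smu !linearD linearDl.
Qed.

Lemma cupDr f g g' l : cup f (fun x => g x + g' x) l = cup f g l + cup f g' l.
Proof.
by rewrite -big_split /=; apply: eq_bigr => k _; rewrite /smu linearD linearDr.
Qed.

Lemma cupNl f g l : cup (fun x => - f x) g l = - cup f g l.
Proof.
by rewrite -sumrN; apply: eq_bigr => k _; rewrite /smu !linearN linearNl.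
Qed.

Lemma cupNr f g l : cup f (fun x => - g x) l = - cup f g l.
Proof.
by rewrite -sumrN; apply: eq_bigr => k _; rewrite /smu linearN linearNr.
Qed.

Section Coderivation.
Variables (B : seq T -> T) (sigma al : T -> T) (f g : seq T -> A).
Hypothesis epsA_al : forall a, epsA (alA a) = alA (epsA a).
Hypothesis f_al : forall l, f (map al l) = alA (f l).
Hypothesis g_al : forall l, g (map al l) = alA (g l).
Hypothesis f_sigma : forall l, f (map sigma l) = - epsA (f l).

(** The value of [B] is a single letter, so a cut of the new word never splits it: the letter lies
    wholly in the left or in the right half. In the second case [sigma] acts on the entire left
    half, which gives the factor [- epsA]. *)
Lemma coder_cup l :
  coder B sigma al (cup f g) l =
  cup (coder B sigma al f) g l
  + cup (fun x => - epsA (f x)) (coder B sigma al g) l.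
Proof.
have map_iter (f0 : seq T -> A) n l0 : (forall l, f0 (map al l) = alA (f0 l)) ->
    f0 [seq iter n al x | x <- l0] = iter n alA (f0 l0).
  move=> f0_al; elim: n => [|n IHn] /=; first by rewrite map_id.
  by rewrite -IHn -f0_al -map_comp.
set n := size l.
(* [X] records the cuts before the inserted letter and [Y] those after it, both indexed by positions
   in the original word [l]. *)
pose X r e k := smu (iter (n - k.+1) alA (- epsA (f (take k l))))
  (iter k.-1 alA (g (insert_op B sigma al (r - k) (e - k) (drop k l)))).
pose Y r e k := smu (iter (n - k.+1) alA (f (insert_op B sigma al r e (take k l))))
  (iter k.-1 alA (g (drop k l))).
transitivity (\sum_(0 <= r < n) \sum_(r.+1 <= e < n.+1)
   (\sum_(1 <= k < r.+1) X r e k + \sum_(e <= k < n) Y r e k)).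
  apply: eq_big_nat => r rn; apply: eq_big_nat => e re.
  rewrite /cup size_insert_op -/n; last by lia.
  rewrite (@big_cat_nat _ _ _ r.+1) /=; [|lia..]; congr (_ + _).
    apply: eq_big_nat => k kr.
    rewrite take_insert_op_before ?drop_insert_op_before; [|lia..].
    rewrite /X; congr (smu _ _).
    rewrite (map_comp sigma) f_sigma map_iter // (iter_morph _ epsA_al).
    rewrite -!linearN -!iterD; congr (iter _ _ _); lia.
  (* Insertion shortens the word by [e - r.+1], so a cut [k] after the inserted letter corresponds
     to the cut [k + (e - r.+1)] of [l]. *)
  have -> : \sum_(e <= k < n) Y r e k =
            \sum_(r.+1 <= k < n - (e - r.+1)) Y r e (k + (e - r.+1))%N.
    by rewrite -{1}(@subnKC r.+1 e) ?big_addn //; lia.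
  apply: eq_big_nat => k kr.
  rewrite -[k in take k _](addnK (e - r.+1)%N) -[k in drop k _](addnK (e - r.+1)%N).
  rewrite take_insert_op_after ?drop_insert_op_after; [|lia..].
  rewrite /Y map_iter // -iterD; congr (smu (iter _ _ _) (iter _ _ _)); lia.
under eq_bigr => r _ do rewrite big_split /=.
rewrite big_split /= [LHS]addrC; congr (_ + _).
  under eq_big_nat => r rn.
    rewrite big_nat_recr //=.
    rewrite [X in _ + X]big_geq // addr0.
    rewrite sum_triangle.
    over.
  rewrite sum_triangle_lt; apply: eq_big_nat => k kn.
  rewrite linear_sum smu_suml size_takel; last by lia.
  by apply: eq_big_nat => r rk; rewrite linear_sum smu_suml.
under eq_bigr => r _ do rewrite exchange_big_nat /=.
transitivity (\sum_(0 <= r < n) \sum_(1 <= k < r.+1)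
   \sum_(r.+1 <= e < n.+1) X r e k); first by [].
transitivity (\sum_(1 <= k < n) \sum_(k <= r < n) \sum_(r.+1 <= e < n.+1) X r e k).
  rewrite sum_triangle; case: (n) => [|n']; first by rewrite !big_geq.
  by rewrite big_ltn // [X in X + _]big_geq ?add0r.
apply: eq_big_nat => k kn; rewrite linear_sum smu_sumr size_drop -/n.
rewrite -{1}[k]add0n big_addn; apply: eq_big_nat => r rk.
rewrite linear_sum smu_sumr -addSn big_addn subSn; last by lia.
by apply: eq_big_nat => e re; rewrite /X !addnK.
Qed.

End Coderivation.

(** Both sides are sums over two cuts [j < k] of [l], and they agree term by term through
    hom-associativity. The [epsA] on the right is the sign of the shifted product. *)
Lemma cup_assoc f g q l :
  (forall a, epsA (alA a) = alA (epsA a)) ->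
  (forall a b, alA (mu a b) = mu (alA a) (alA b)) ->
  (forall a b c, mu (alA a) (mu b c) = mu (mu a b) (alA c)) ->
  (forall a b, epsA (mu a b) = mu (epsA a) (epsA b)) ->
  cup (cup f g) q l = cup (fun x => epsA (f x)) (cup g q) l.
Proof.
move=> epsA_al al_mu hom_assoc eps_mu.
have al_smu n a b : iter n alA (smu a b) = smu (iter n alA a) (iter n alA b).
  rewrite /smu (iter_morph _ epsA_al).
  by elim: n => //= n ->.
set n := size l.
pose X j k := smu (iter (n - j.+1) alA (epsA (f (take j l))))
  (iter j.-1 alA (smu (iter (n - j - (k - j).+1) alA (g (take (k - j) (drop j l))))
     (iter (k - j).-1 alA (q (drop (k - j) (drop j l)))))).
transitivity (\sum_(1 <= k < n) \sum_(1 <= j < k) X j k); last first.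
  transitivity (\sum_(1 <= j < n) \sum_(j.+1 <= k < n) X j k).
    rewrite sum_triangle_lt; case: (n) => [|[|n']]; [by rewrite !big_geq..|].
    by rewrite [LHS]big_ltn // [X in X + _]big_geq ?add0r.
  apply: eq_big_nat => j jn.
  rewrite linear_sum smu_sumr size_drop -/n -add1n big_addn.
  by apply: eq_big_nat => k kn; rewrite /X !addnK.
apply: eq_big_nat => k kn.
rewrite linear_sum smu_suml size_takel; last by lia.
apply: eq_big_nat => j jk; rewrite /X /= -/n !al_smu -!iterD take_takel; last by lia.
rewrite drop_drop take_drop subnK; last by lia.
have -> : (n - k.+1 + (k - j.+1) = (n - j - 2))%N by lia.
have -> : (j.-1 + (n - j - (k - j).+1) = (n - k.+1 + j.-1))%N by lia.
(* One copy of [alA] is split off from the last factor on the left side and from the first factor on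
   the right side, which is the shape required by [hom_assoc]. *)
have -> : (k.-1 = (j.-1 + (k - j).-1).+1)%N by lia.
have -> : (n - j.+1 = (n - j - 2).+1)%N by lia.
rewrite /smu /= !(iter_morph _ epsA_al) epsA_al hom_assoc eps_mu.
by rewrite !(iter_morph _ epsA_al).
Qed.
End Cup.

(** * Linearity of coderivations and their projection to single letters *)

Section CoderTheory.
Variables (T : Type) (B : seq T -> T) (sigma al : T -> T).

Lemma coderB (V : zmodType) (f g : seq T -> V) l :
  coder B sigma al (fun x => f x - g x) l
  = coder B sigma al f l - coder B sigma al g l.
Proof. by rewrite -sumrB; apply: eq_bigr => r _; rewrite -sumrB. Qed.

Lemma coderD (V : zmodType) (f g : seq T -> V) l :
  coder B sigma al (fun x => f x + g x) l
  = coder B sigma al f l + coder B sigma al g l.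
Proof. by rewrite -big_split; apply: eq_bigr => r _; rewrite -big_split. Qed.

Lemma coder_linear (F : fieldType) (V W : lmodType F) (u : {linear V -> W})
    (f : seq T -> V) l :
  coder B sigma al (fun x => u (f x)) l = u (coder B sigma al f l).
Proof. by rewrite linear_sum; apply: eq_bigr => r _; rewrite linear_sum. Qed.

Lemma eq_coder (V : zmodType) (f g : seq T -> V) l :
  f =1 g -> coder B sigma al f l = coder B sigma al g l.
Proof. by move=> fg; apply: eq_bigr => r _; apply: eq_bigr => e _; rewrite fg. Qed.

(** Only the insertion that consumes the whole word, with [r = 0] and [e = size l], leaves a word of
    length one. *)
Lemma coder_singleton (V : zmodType) (f : seq T -> V) l :
  (forall l, size l != 1%N -> f l = 0) -> (0 < size l)%N ->
  coder B sigma al f l = f [:: B l].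
Proof.
move=> f0 l_gt0; rewrite /coder big_ltn // big_nat_recr //=.
rewrite big_nat_cond big1 => [|e /andP[re _]]; last first.
  by apply: f0; rewrite size_insert_op; lia.
rewrite [X in _ + _ + X]big_nat_cond big1 => [|r /andP[rl _]]; last first.
  rewrite big_nat_cond big1 // => e /andP[re _].
  by apply: f0; rewrite size_insert_op; lia.
by rewrite add0r addr0 /insert_op take0 drop0 take_size drop_size.
Qed.

End CoderTheory.

(** * The transferred operations on the shifted space *)

Section Transfer.
Variables (F : fieldType) (A H : lmodType F).
Variables (p : {linear A -> H}) (i : {linear H -> A}) (h : {linear A -> A}).
Variables (mu : {bilinear A -> A -> A}) (alA dA epsA : {linear A -> A}).
Variables (alH dH epsH : {linear H -> H}).
Hypothesis epsA_al : forall a, epsA (alA a) = alA (epsA a).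
Hypothesis epsA_mu : forall a b, epsA (mu a b) = mu (epsA a) (epsA b).
Hypothesis epsA_h : forall a, epsA (h a) = - h (epsA a).
Hypothesis epsA_d : forall a, epsA (dA a) = - dA (epsA a).
Hypothesis epsA_i : forall x, epsA (i x) = i (epsH x).
Hypothesis epsH_p : forall a, epsH (p a) = p (epsA a).
Hypothesis epsH_d : forall x, epsH (dH x) = - dH (epsH x).
Hypothesis al_mu : forall a b, alA (mu a b) = mu (alA a) (alA b).
Hypothesis hom_assoc : forall a b c, mu (alA a) (mu b c) = mu (mu a b) (alA c).
Hypothesis al_h : forall a, alA (h a) = h (alA a).
Hypothesis al_d : forall a, alA (dA a) = dA (alA a).
Hypothesis al_i : forall x, alA (i x) = i (alH x).
Hypothesis al_p : forall a, alH (p a) = p (alA a).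
Hypothesis alH_d : forall x, alH (dH x) = dH (alH x).
Hypothesis i_d : forall x, i (dH x) = dA (i x).
Hypothesis p_d : forall a, p (dA a) = dH (p a).
Hypothesis dd : forall x, dH (dH x) = 0.
Hypothesis d_mu : forall a b, dA (mu a b) = mu (dA a) b + mu (epsA a) (dA b).
Hypothesis homotopy : forall a, a - i (p a) = dA (h a) + h (dA a).

Local Notation hcup := (@cup F A H mu epsA alA).
Local Notation sigma := (fun x => - epsH x).

Definition on_singleton (V : zmodType) (u : H -> V) (l : seq H) : V :=
  if l is [:: x] then u x else 0.

(** The recursion is on the length of the word, not on its structure; [n] is a bound on that length,
    which drops because [cup] evaluates its arguments on proper factors only. *)
Fixpoint phi_rec n (l : seq H) : A :=
  if n is n'.+1 then on_singleton i l - h (hcup (phi_rec n') (phi_rec n') l)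
  else 0.

Definition phi l := phi_rec (size l) l.
Definition lam l := hcup phi phi l.
(** Unfolded, [p (lam l)] is the sum over planar binary trees with [i] at the leaves, the shifted
    product at the vertices, [- h] on the inner edges and [p] at the root, corrected by powers of
    [alA]. *)
Definition bmap l := on_singleton dH l + p (lam l).

Lemma cup_nil f g : hcup f g [::] = 0.
Proof. exact: big_geq. Qed.

Lemma phi_rec_stable n n' l : (size l <= n)%N -> (size l <= n')%N ->
  phi_rec n l = phi_rec n' l.
Proof.
have nil0 k : phi_rec k [::] = 0 by case: k => //= k; rewrite cup_nil linear0 subr0.
elim: n n' l => [|n IHn] [|n'] l /=;
  try by case: l => // _ _; rewrite cup_nil linear0 subr0.
move=> ln ln'; congr (_ - h _); apply: eq_cup => k kl; apply: IHn;
  rewrite ?size_drop ?size_takel; lia.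
Qed.

Lemma phiE l : phi l = on_singleton i l - h (lam l).
Proof.
rewrite /phi /lam; case: l => [|x l]; first by rewrite /= cup_nil linear0 subr0.
rewrite [phi_rec _ _]/=; congr (_ - h _); apply: eq_cup => k kl; apply: phi_rec_stable;
  rewrite ?size_drop ?size_takel //=; move: kl => /=; lia.
Qed.

Lemma cup_al f g l :
  (forall l, f (map alH l) = alA (f l)) -> (forall l, g (map alH l) = alA (g l)) ->
  hcup f g (map alH l) = alA (hcup f g l).
Proof.
move=> fal gal; rewrite /cup linear_sum size_map; apply: eq_bigr => k _.
rewrite -map_take -map_drop fal gal /smu al_mu -epsA_al.
by congr (mu (epsA _) _); rewrite -iterSr iterS.
Qed.

(** The minus signs of the two factors cancel. In [phi_sigma] the map [h], which anticommutes with
    [epsA], restores the sign. *)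
Lemma cup_sigma f g l :
  (forall l, f (map sigma l) = - epsA (f l)) ->
  (forall l, g (map sigma l) = - epsA (g l)) ->
  hcup f g (map sigma l) = epsA (hcup f g l).
Proof.
move=> fs gs; rewrite /cup linear_sum size_map; apply: eq_bigr => k _.
rewrite -map_take -map_drop fs gs /smu epsA_mu !linearN /= linearNl opprK.
by rewrite -!(iter_morph _ epsA_al).
Qed.

Lemma phi_al l : phi (map alH l) = alA (phi l).
Proof.
rewrite /phi size_map; elim: (size l) {2 4}l => [|n IHn] l' /=.
  by rewrite linear0.
rewrite cup_al // linearB al_h; congr (_ - _).
by case: l' => [|x [|y l']]; rewrite /= ?linear0 ?al_i.
Qed.

Lemma phi_sigma l : phi (map sigma l) = - epsA (phi l).
Proof.
rewrite /phi size_map; elim: (size l) {2 4}l => [|n IHn] l' /=.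
  by rewrite linear0 oppr0.
rewrite cup_sigma // linearB epsA_h opprD !opprK; congr (_ - _).
by case: l' => [|x [|y l']]; rewrite /= ?linear0 ?oppr0 // epsA_i linearN.
Qed.

Local Notation hcoder := (coder bmap sigma alH).

(** The minus sign arises from moving [dA] past the [epsA] hidden in [smu]. *)
Lemma d_cup f g l :
  dA (hcup f g l) =
  - hcup (fun x => dA (f x)) g l + hcup (fun x => epsA (f x)) (fun x => dA (g x)) l.
Proof.
rewrite /cup linear_sum -sumrN -big_split; apply: eq_bigr => k _ /=.
rewrite /smu d_mu -[dA (epsA _)]opprK -epsA_d linearNl.
have dal n a : dA (iter n alA a) = iter n alA (dA a).
  exact: (iter_morph n (fun a => esym (al_d a))).
by rewrite !dal !(iter_morph _ epsA_al).
Qed.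

(** In the Leibniz formula for [phi * phi], both [phi] are evaluated on shorter words, so [dA phi]
    may be replaced by [hcoder phi - lam]. The terms with [hcoder phi] form [- hcoder lam] by the
    derivation rule; the two terms with [lam] cancel by [cup_assoc]. *)
Lemma d_lam_of_d_phi l :
  (forall l', (size l' < size l)%N -> dA (phi l') + lam l' = hcoder phi l') ->
  dA (lam l) = - hcoder lam l.
Proof.
move=> d_phi; rewrite /lam d_cup.
have dphi l' : (size l' < size l)%N -> dA (phi l') = hcoder phi l' - lam l'.
  by move=> /d_phi <-; rewrite addrK.
rewrite (@eq_cup _ _ _ _ _ _ (fun x => dA (phi x)) (fun x => hcoder phi x - lam x)
  phi phi) => [|k kl|//]; last by apply: dphi; rewrite size_takel; lia.
rewrite (@eq_cup _ _ _ _ _ _ (fun x => epsA (phi x)) (fun x => epsA (phi x))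
  (fun x => dA (phi x)) (fun x => hcoder phi x - lam x)) => [|//|k kl]; last first.
  by apply: dphi; rewrite size_drop; lia.
rewrite cupDl cupDr cupNl cupNr -cup_assoc //.
rewrite coder_cup //; [|exact: phi_al..|exact: phi_sigma].
by rewrite cupNl !opprD !opprK addrACA [X in _ + X](subrr (hcup lam phi l)) addr0.
Qed.

(** The homotopy identity gives [dA (h lam) = lam - i (p lam) - h (dA lam)]. Hence [dA phi + lam]
    equals [dA i + i (p lam) + h (dA lam)], whose first two terms combine to [i bmap], while the
    last is [- h (hcoder lam)]. *)
Lemma d_phi_of_d_lam l : dA (lam l) = - hcoder lam l ->
  dA (phi l) + lam l = hcoder phi l.
Proof.
move=> d_lam; have -> : hcoder phi l =
    hcoder (on_singleton i) l - h (hcoder lam l).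
  rewrite -coder_linear -coderB; apply: eq_coder; exact: phiE.
have -> : hcoder (on_singleton i) l = i (bmap l).
  case: l {d_lam} => [|x l]; last by rewrite coder_singleton // => -[|y [|z l']].
  by rewrite /coder /= big_geq // /bmap /= /lam cup_nil !linear0 addr0 linear0.
rewrite phiE linearB -[hcoder lam l]opprK -d_lam linearN opprK.
rewrite [X in _ + X = _](canRL (subrK _) (homotopy (lam l))) /bmap linearD /=.
have -> : i (on_singleton dH l) = dA (on_singleton i l).
  by case: l {d_lam} => [|x [|y l]]; rewrite /= ?linear0 // i_d.
by rewrite -!addrA addKr [h _ + _]addrC.
Qed.

(** The two preceding implications are interlocked: the formula for [lam] on shorter words gives the
    one for [phi] on these words, and this gives [lam] at [l]. *)
Lemma d_lam l : dA (lam l) = - hcoder lam l.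
Proof.
have [n] := ubnP (size l); elim: n l => // n IHn l ln.
apply: d_lam_of_d_phi => l' l'l; apply: d_phi_of_d_lam; apply: IHn; lia.
Qed.

(** The sum equals [dH (bmap l) + p (hcoder lam l)]. By [d_lam] the second term is
    [- dH (p (lam l))], so only [dH] applied twice remains. *)
Lemma stasheff l : hcoder bmap l = 0.
Proof.
case: l => [|x l]; first by rewrite /coder /= big_geq.
have -> : hcoder bmap (x :: l) =
    hcoder (on_singleton dH) (x :: l) + p (hcoder lam (x :: l)).
  by rewrite -coder_linear -coderD.
rewrite coder_singleton // => [|[|y [|z l']] //]; rewrite [on_singleton _ _]/=.
rewrite -[hcoder lam _]opprK -d_lam linearN p_d {1}/bmap linearD.
by case: l => [|y l]; rewrite /= ?linear0 ?dd !add0r subrr.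
Qed.

Lemma bmap_al l : alH (bmap l) = bmap (map alH l).
Proof.
rewrite /bmap linearD al_p /lam -cup_al; [|exact: phi_al..]; congr (_ + _).
by case: l => [|x [|y l]]; rewrite /= ?linear0 // alH_d.
Qed.

Lemma bmap_sigma l : bmap (map sigma l) = epsH (bmap l).
Proof.
rewrite /bmap linearD epsH_p /lam cup_sigma; [|exact: phi_sigma..]; congr (_ + _).
by case: l => [|x [|y l]]; rewrite /= ?linear0 // epsH_d linearN.
Qed.

End Transfer.

(** * Multilinearity of the transferred operations *)

Section Multilinear.
Variable F : fieldType.

(** Stating this on words treats all arities at once and is compatible with cutting words. *)
Definition seq_multilinear (V W : lmodType F) (f : seq V -> W) :=
  forall l1 l2, linear (fun x => f (l1 ++ x :: l2)).

Lemma seq_multilinearD (V W : lmodType F) (f g : seq V -> W) :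
  seq_multilinear f -> seq_multilinear g ->
  seq_multilinear (fun l => f l + g l).
Proof. by move=> fl gl l1 l2 c x y; rewrite fl gl scalerDr addrACA. Qed.

Lemma seq_multilinear_comp (V W X : lmodType F) (u : {linear W -> X}) (f : seq V -> W) :
  seq_multilinear f -> seq_multilinear (fun l => u (f l)).
Proof. by move=> fl l1 l2 c x y; rewrite fl linearP. Qed.

Lemma seq_multilinear_singleton (V W : lmodType F) (u : {linear V -> W}) :
  seq_multilinear (on_singleton u).
Proof.
move=> [|z [|w l1]] [|z' l2] c x y; rewrite /= ?scaler0 ?addr0 //; exact: linearP.
Qed.

(** At each cut the varying letter lies in exactly one half, and everything applied to that half is
    linear. *)
Lemma seq_multilinear_cup (A V : lmodType F) (mu : {bilinear A -> A -> A})
    (epsA alA : {linear A -> A}) (f g : seq V -> A) :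
  seq_multilinear f -> seq_multilinear g ->
  seq_multilinear (cup mu epsA alA f g).
Proof.
move=> fl gl l1 l2 c x y; rewrite /cup !size_cat /= scaler_sumr -big_split /=.
apply: eq_big_nat => k kn; rewrite !take_cat_sub !drop_cat_sub.
case: (leqP k (size l1)) => [kl|lk].
  rewrite (_ : k - size l1 = 0)%N; last by lia.
  by rewrite gl linearP /smu /= linearPr.
rewrite -(subnSK lk) /=.
by rewrite fl /smu !linearP /= linearPl.
Qed.

Section TransferMultilinear.
Variables (A H : lmodType F).
Variables (p : {linear A -> H}) (i : {linear H -> A}) (h : {linear A -> A}).
Variables (mu : {bilinear A -> A -> A}) (alA epsA : {linear A -> A}).
Variables (dH : {linear H -> H}).

Lemma seq_multilinear_phi : seq_multilinear (phi i h mu alA epsA).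
Proof.
have phi_n n : seq_multilinear (phi_rec i h mu alA epsA n).
  elim: n => [|n IHn] l1 l2 c x y /=; first by rewrite scaler0 addr0.
  rewrite seq_multilinear_singleton seq_multilinear_cup // (linearP h) /=.
  by rewrite opprD scalerBr addrACA.
by move=> l1 l2 c x y; rewrite /phi !size_cat /= -!addSnnS phi_n.
Qed.

Lemma seq_multilinear_bmap : seq_multilinear (bmap p i h mu alA epsA dH).
Proof.
apply: seq_multilinearD; first exact: seq_multilinear_singleton.
by apply/seq_multilinear_comp/seq_multilinear_cup; exact: seq_multilinear_phi.
Qed.

End TransferMultilinear.
End Multilinear.

(** * Degrees of the transferred operations *)

Section Degree.
Variable F : fieldType.
Implicit Types V W : gvect F.

Lemma gpart0 V n : 0 \in gpart V n.
Proof. by case: (gpart_submod V n). Qed.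

Lemma gpartP V n (c : F) x y :
  x \in gpart V n -> y \in gpart V n -> c *: x + y \in gpart V n.
Proof. by case: (gpart_submod V n) => _; apply. Qed.

Lemma gpartZ V n (c : F) x : x \in gpart V n -> c *: x \in gpart V n.
Proof. by move=> xV; rewrite -[c *: x]addr0 gpartP ?gpart0. Qed.

Lemma gpartD V n (x y : V) :
  x \in gpart V n -> y \in gpart V n -> x + y \in gpart V n.
Proof. by move=> xV yV; rewrite -[x]scale1r gpartP. Qed.

Lemma gpartN V n (x : V) : x \in gpart V n -> - x \in gpart V n.
Proof. by move=> xV; rewrite -scaleN1r gpartZ. Qed.

Lemma gpart_sum V n (I : eqType) (r : seq I) (E : I -> V) :
  (forall j, j \in r -> E j \in gpart V n) -> \sum_(j <- r) E j \in gpart V n.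
Proof.
move=> EV; rewrite big_seq; apply: (big_ind (fun v => v \in gpart V n)) => //.
  exact: gpart0.
exact: gpartD.
Qed.

Definition homog V (d : seq int) (l : seq V) :=
  all2 (fun n x => x \in gpart V n) d l.

Lemma homog_take V d l k : homog (V := V) d l -> homog (take k d) (take k l).
Proof.
elim: d l k => [|n d IHd] [|x l] [|k] //= /andP[xV dl].
by rewrite /homog /=; apply/andP; split; last exact: IHd.
Qed.

Lemma homog_drop V d l k : homog (V := V) d l -> homog (drop k d) (drop k l).
Proof.
elim: d l k => [|n d IHd] [|x l] [|k] //= /andP[xV dl].
exact: IHd.
Qed.

(** Each letter counts one more than its degree, as in the shifted space, so [cup] simply adds the
    numbers [q]. An operation of arity [k] and degree [k - 2] has [q = -2]. *)
Definition seq_degree V W (q : int) (f : seq V -> W) :=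
  forall d l, homog d l -> f l \in gpart W (\sum_(n <- d) n + (size l)%:Z + q).

Lemma has_degree_iter V (u : V -> V) k : has_degree 0 u -> has_degree 0 (iter k u).
Proof.
by move=> u0 n x xV; rewrite addr0; elim: k => //= k IHk; rewrite -[n]addr0 u0.
Qed.

Lemma seq_degree_cup (A : gvect F) V (mu : {bilinear A -> A -> A})
    (epsA alA : {linear A -> A}) (q1 q2 : int) (f g : seq V -> A) :
  (forall (m n : int) (a b : A), a \in gpart A m -> b \in gpart A n ->
     mu a b \in gpart A (m + n)) ->
  has_degree 0 epsA -> has_degree 0 alA ->
  seq_degree q1 f -> seq_degree q2 g ->
  seq_degree (q1 + q2) (cup mu epsA alA f g).
Proof.
move=> mu0 eps0 al0 fq gq d l dl; apply: gpart_sum => k; rewrite mem_index_iota => kn.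
have /eps0 := has_degree_iter (size l - k.+1) al0 (fq _ _ (homog_take k dl)).
rewrite !addr0 => fk.
have := has_degree_iter k.-1 al0 (gq _ _ (homog_drop k dl)).
rewrite addr0 => /(mu0 _ _ _ _ fk).
rewrite size_takel ?size_drop; last by lia.
rewrite -[in X in _ -> _ \in gpart A X](cat_take_drop k d) big_cat /= -subzn; last by lia.
set s1 := \sum_(_ <- take k d) _; set s2 := \sum_(_ <- drop k d) _.
by congr (_ \in gpart A _); lia.
Qed.

Lemma seq_degree_singleton V W (u : V -> W) q :
  has_degree (1 + q) u -> seq_degree q (on_singleton u).
Proof.
move=> uq d [|x [|y l]]; rewrite /= ?gpart0 //; case: d => [|n [|m d]] //=.
  by rewrite /homog /= andbT => xV; rewrite big_seq1 -addrA uq.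
by rewrite /homog /= andbF.
Qed.

Section TransferDegree.
Variables (A H : gvect F).
Variables (p : {linear A -> H}) (i : {linear H -> A}) (h : {linear A -> A}).
Variables (mu : {bilinear A -> A -> A}) (alA epsA : {linear A -> A}).
Variables (dH : {linear H -> H}).
Hypothesis mu_degree : forall (m n : int) (a b : A),
  a \in gpart A m -> b \in gpart A n -> mu a b \in gpart A (m + n).
Hypothesis p0 : has_degree 0 p.
Hypothesis i0 : has_degree 0 i.
Hypothesis h1 : has_degree 1 h.
Hypothesis al0 : has_degree 0 alA.
Hypothesis eps0 : has_degree 0 epsA.
Hypothesis dHN1 : has_degree (-1) dH.

Lemma seq_degree_phi : seq_degree (-1) (phi i h mu alA epsA).
Proof.
have phi_n n : seq_degree (-1) (phi_rec i h mu alA epsA n).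
  elim: n => [|n IHn] d l dl /=; first exact: gpart0.
  apply: gpartD; first exact: (@seq_degree_singleton _ _ i (-1)).
  apply: gpartN; have /h1 := seq_degree_cup mu_degree eps0 al0 IHn IHn dl.
  by rewrite -addrA.
by move=> d l dl; apply: phi_n.
Qed.

Lemma seq_degree_bmap : seq_degree (- 2) (bmap p i h mu alA epsA dH).
Proof.
move=> d l dl; apply: gpartD; first exact: (@seq_degree_singleton _ _ dH (-2)).
have := seq_degree_cup mu_degree eps0 al0 seq_degree_phi seq_degree_phi dl.
by move=> /p0; rewrite addr0.
Qed.

End TransferDegree.
End Degree.

(** * Construction of the parity operator of a graded space *)

Section Parity.
Variables (F : fieldType) (V : gvect F).

Lemma gpart_ind (P : V -> Prop) :
  P 0 -> (forall x y, P x -> P y -> P (x + y)) ->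
  (forall n x, x \in gpart V n -> P x) -> forall x, P x.
Proof.
move=> P0 PD Pn x; have [s [c [cV ->]]] := gpart_span x.
by apply: big_ind => // n _; apply: Pn (cV n).
Qed.

(** Homogeneous decompositions are only known to exist, so the operator is first built as a
    relation; spanning makes it total and independence makes it single-valued. *)
Inductive parity_graph : V -> V -> Prop :=
| parity_graph0 : parity_graph 0 0
| parity_graphD n v x y : v \in gpart V n -> parity_graph x y ->
    parity_graph (v + x) ((-1) ^ n *: v + y).

Lemma parity_graph_total x : exists y, parity_graph x y.
Proof.
have [s [c [cV ->]]] := gpart_span x.
elim: s => [|n s [y IHs]]; first by exists 0; rewrite big_nil; constructor.
by exists ((-1) ^ n *: c n + y); rewrite big_cons; constructor.
Qed.

Lemma parity_graphP (c : F) x y x' y' :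
  parity_graph x y -> parity_graph x' y' ->
  parity_graph (c *: x + x') (c *: y + y').
Proof.
move=> xy xy'; elim: xy => [|n v x1 y1 vV _ IH]; first by rewrite scaler0 !add0r.
rewrite !scalerDr -!addrA scalerA mulrC -scalerA; constructor=> //; exact: gpartZ.
Qed.

(** Summands of equal degree are merged, since independence is available only for lists of distinct
    degrees. *)
Lemma parity_graph_sum x y : parity_graph x y -> exists s (c : int -> V),
  [/\ uniq s, forall n, c n \in gpart V n, x = \sum_(n <- s) c n
    & y = \sum_(n <- s) (-1) ^ n *: c n].
Proof.
elim=> [|n v x1 y1 vV _ [s [c [s_uniq cV -> ->]]]].
  by exists [::], (fun=> 0); rewrite !big_nil; split=> // n; exact: gpart0.
have [ns|ns] := boolP (n \in s); last first.
  exists (n :: s), (fun m => if m == n then v else c m).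
  have cs m : m \in s -> (m == n) = false by move=> ms; apply: contraNF ns => /eqP <-.
  rewrite !big_cons /= ns s_uniq eqxx; split=> //.
  - by move=> m; case: eqP => // ->.
  - by congr (_ + _); apply: eq_big_seq => m /cs ->.
  - by congr (_ + _); apply: eq_big_seq => m /cs ->.
exists s, (fun m => if m == n then v + c n else c m); split=> //.
- by move=> m; case: eqP => // ->; exact: gpartD.
- rewrite !(bigD1_seq n) //= eqxx addrA; congr (_ + _).
  by apply: eq_bigr => m /negPf ->.
rewrite !(bigD1_seq n) //= eqxx scalerDr addrA; congr (_ + _).
by apply: eq_bigr => m /negPf ->.
Qed.

(** By linearity of the relation, [0] is related to [y' - y]; all components of a decomposition of
    [0] vanish. *)
Lemma parity_graph_fun x y y' : parity_graph x y -> parity_graph x y' -> y = y'.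
Proof.
move=> xy xy'; apply/esym/eqP; rewrite -subr_eq0 addrC -scaleN1r; apply/eqP.
have := parity_graphP (-1) xy xy'; rewrite (scaleN1r x) addNr.
move=> /parity_graph_sum[s [c [s_uniq cV /esym c0 ->]]].
by rewrite big_seq big1 // => n ns; rewrite (gpart_indep s_uniq cV c0 ns) scaler0.
Qed.

Lemma parity_involution : exists eps : {linear V -> V},
  forall n x, x \in gpart V n -> eps x = (-1) ^ n *: x.
Proof.
have [f fP] := functional_choice _ parity_graph_total.
have f_lin : linear f.
  move=> c x y; apply: (@parity_graph_fun (c *: x + y)); first exact: fP.
  exact: parity_graphP.
pose f_mixin := GRing.isLinear.Build F V V *:%R f f_lin.
pose g : {linear V -> V} := HB.pack f f_mixin.
exists g => n x xV /=; apply: (@parity_graph_fun x) => //.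
rewrite -{1}[x]addr0 -[_ *: x]addr0; constructor=> //; exact: parity_graph0.
Qed.

End Parity.

Definition is_parity (F : fieldType) (V : gvect F) (eps : V -> V) :=
  forall n x, x \in gpart V n -> eps x = (-1) ^ n *: x.

Section ParityTheory.
Variable F : fieldType.

Lemma parity_has_degree (V : gvect F) (eps : {linear V -> V}) :
  is_parity eps -> has_degree 0 eps.
Proof. by move=> epsP n x xV; rewrite (epsP n) // addr0 gpartZ. Qed.

Lemma signz_sqr (n : int) : (-1) ^ n * (-1) ^ n = 1 :> F.
Proof.
case: n => n; first by rewrite -[LHS]/(((-1) ^+ n) * ((-1) ^+ n)) -expr2 sqrr_sign.
by rewrite NegzE -exprz_inv invrN1 -[LHS]/(((-1) ^+ n.+1) ^+ 2) sqrr_sign.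
Qed.

Lemma parityK (V : gvect F) (eps : {linear V -> V}) :
  is_parity eps -> involutive eps.
Proof.
move=> epsP; apply: gpart_ind => [|x y|n x xV]; rewrite ?linear0 //.
  by rewrite !linearD => -> ->.
rewrite (epsP n x xV) linearZ /= (epsP n x xV) scalerA signz_sqr.
by rewrite scale1r.
Qed.

(** This is the source of every sign rule between the parity operators and the structure maps, with
    [q] equal to 0, 1 or -1. *)
Lemma parity_commute (V W : gvect F) (epsV : {linear V -> V}) (epsW : {linear W -> W})
    (q : int) (u : {linear V -> W}) :
  is_parity epsV -> is_parity epsW -> has_degree q u ->
  forall x, epsW (u x) = (-1) ^ q *: u (epsV x).
Proof.
move=> epsVP epsWP uq; apply: gpart_ind => [|x y|n x xV]; rewrite ?linear0 ?scaler0 //.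
  by rewrite !linearD => -> ->.
rewrite (epsWP (n + q)) ?uq // (epsVP n) // linearZ scalerA /= mulrC -expfzDr //.
by rewrite oppr_eq0 oner_eq0.
Qed.

End ParityTheory.

(** * Signs for undoing the shift *)

Section Desuspension.
Variables (F : fieldType) (V : lmodType F) (eps : {linear V -> V}).

(** These are the Koszul signs for applying one shift to each letter: a letter is passed by the
    shifts of all letters to its right. *)
Fixpoint twist (l : seq V) : seq V :=
  if l is x :: l' then iter (size l') eps x :: twist l' else [::].

Lemma size_twist l : size (twist l) = size l.
Proof. by elim: l => //= x l ->. Qed.

Lemma twist_cat l1 l2 :
  twist (l1 ++ l2) = map (iter (size l2) eps) (twist l1) ++ twist l2.
Proof. by elim: l1 => //= x l1 ->; rewrite size_cat addnC iterD. Qed.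

Lemma twist_map (u : V -> V) l : (forall x, eps (u x) = u (eps x)) ->
  twist (map u l) = map u (twist l).
Proof.
move=> eps_u; elim: l => //= x l ->; rewrite size_map; congr (_ :: _).
by elim: (size l) => //= n ->.
Qed.

(** The global sign is chosen to produce the exponent [r s + t] of the Stasheff relation; it is
    trivial in arities one and two. *)
Definition desuspend (W : lmodType F) (f : seq V -> W) (l : seq V) : W :=
  (-1) ^+ 'C((size l).-1, 2) *: f (twist l).

Lemma seq_multilinear_desuspend (W : lmodType F) (f : seq V -> W) :
  seq_multilinear f -> seq_multilinear (desuspend f).
Proof.
move=> fl l1 l2 c x y; rewrite /desuspend !twist_cat /= !size_cat /= linearP fl.
by rewrite scalerDr !scalerA mulrC.
Qed.

Lemma seq_multilinear_cat (W : lmodType F) (f : seq V -> W) l :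
  seq_multilinear f -> seq_multilinear (fun l' => f (l ++ l')).
Proof. by move=> fl l1 l2 c x y; rewrite !catA fl. Qed.

Lemma seq_multilinearZ (W : lmodType F) (f : seq V -> W) l1 l2 c x :
  seq_multilinear f -> f (l1 ++ (c *: x) :: l2) = c *: f (l1 ++ x :: l2).
Proof.
move=> fl; have f0 : f (l1 ++ 0 :: l2) = 0.
  by have := fl l1 l2 (-1) 0 0; rewrite scaler0 addr0 scaleN1r addNr.
by have := fl l1 l2 c x 0; rewrite addr0 f0 addr0.
Qed.

Lemma seq_multilinear_scale (W : lmodType F) (f : seq V -> W) c (u : V -> V) l l' :
  seq_multilinear f ->
  f (map (fun x => c *: u x) l ++ l') = c ^+ size l *: f (map u l ++ l').
Proof.
move=> fl; elim: l f fl => [|x l IHl] f fl /=; first by rewrite scale1r.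
rewrite (seq_multilinearZ [::] _ _ _ fl) /= exprS -scalerA; congr (_ *: _).
exact: (IHl _ (seq_multilinear_cat [:: u x] fl)).
Qed.

(** Since [f] turns [- eps] on the letters into [eps] on the value, each [eps] pulled out costs one
    sign per letter. *)
Lemma map_iter_sigma (f : seq V -> V) n l :
  seq_multilinear f ->
  (forall l, f (map (fun x => - eps x) l) = eps (f l)) ->
  f (map (iter n eps) l) = (-1) ^+ (n * size l) *: iter n eps (f l).
Proof.
move=> fl f_eps; elim: n => [|n IHn] /=; first by rewrite map_id scale1r.
have := seq_multilinear_scale (-1) (eps \o iter n eps) l [::] fl.
rewrite !cats0 mulSn exprD -scalerA => fE.
rewrite -[LHS](signrZK (size l)) -fE; congr (_ *: _).
transitivity (eps (f (map (iter n eps) l))).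
  rewrite -f_eps -map_comp; congr f; apply: eq_map => x.
  by rewrite scaleN1r.
by rewrite IHn linearZ.
Qed.

Lemma bin2D m n : 'C(m + n, 2) = ('C(m, 2) + 'C(n, 2) + m * n)%N.
Proof.
elim: n => [|n IHn]; first by rewrite addn0 muln0 addn0 addn0.
by rewrite addnS !binS !bin1 IHn; lia.
Qed.

Variables (al : {linear V -> V}) (f : seq V -> V).
Hypothesis eps_al : forall x, eps (al x) = al (eps x).
Hypothesis f_multilinear : seq_multilinear f.
Hypothesis f_eps : forall l, f (map (fun x => - eps x) l) = eps (f l).

Lemma insert_op_cat (l1 l2 l3 : seq V) sigma :
  insert_op f sigma al (size l1) (size l1 + size l2) (l1 ++ l2 ++ l3) =
  [seq sigma (iter (size l2).-1 al x) | x <- l1]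
  ++ f l2 :: [seq iter (size l2).-1 al x | x <- l3].
Proof.
rewrite /insert_op subnS addKn take_size_cat // catA -size_cat take_size_cat //.
by rewrite !drop_size_cat.
Qed.

(* The sign [rs + t] of the Stasheff relation combines with those of the twist
   to the sign ['C(n - 1, 2)], which only depends on [n = r + s + t]. *)
Lemma desuspend_insert (X M Z : seq V) : (0 < size M)%N ->
  (-1) ^+ (size X * size M + size Z) *:
    desuspend f (map (iter (size M).-1 al) (map (iter (size M) eps) X)
                 ++ desuspend f M :: map (iter (size M).-1 al) Z) =
  (-1) ^+ 'C((size X + size M + size Z).-1, 2) *:
    f (insert_op f (fun x => - eps x) al (size X) (size X + size M)
         (twist (X ++ M ++ Z))).
Proof.
move=> M_gt0.
have eps_al_iter n x : eps (iter n al x) = iter n al (eps x).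
  exact: iter_morph.
have eps_iter n x : eps (iter n eps x) = iter n eps (eps x) by exact: iter_morph.
set s := size M; set r := size X; set t := size Z.
(* On the left side of the claim the exponent [(s + t).+1] is [s] plus the [t + 1] letters to the
   right of the block; on the right side it is [s + t] from the twist plus one from the Koszul sign
   of [f]. *)
pose X1 := map (fun x => iter s.-1 al (iter (s + t).+1 eps x)) (twist X).
pose Z1 := map (iter s.-1 al) (twist Z).
pose M1 := iter t eps (f (twist M)).
have -> : insert_op f (fun x => - eps x) al r (r + s) (twist (X ++ M ++ Z)) =
  map (fun x => (-1) *: (fun x => iter s.-1 al (iter (s + t).+1 eps x)) x) (twist X)
  ++ ((-1) ^+ (t * s) *: M1) :: Z1.
  have := insert_op_cat (map (iter (s + t) eps) (twist X))
    (map (iter t eps) (twist M)) (twist Z) (fun x => - eps x).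
  rewrite !size_map !size_twist -!map_comp => insertE.
  rewrite !twist_cat size_cat insertE.
  congr (_ ++ _ :: _).
    apply: eq_map => x /=; rewrite scaleN1r eps_al_iter; congr (- iter _ _ _).
  by rewrite map_iter_sigma // size_twist.
rewrite seq_multilinear_scale // (seq_multilinearZ _ _ _ _ f_multilinear) size_twist -/r.
have -> : desuspend f (map (iter s.-1 al) (map (iter s eps) X)
      ++ desuspend f M :: map (iter s.-1 al) Z) =
   (-1) ^+ 'C(r + t, 2) *: ((-1) ^+ 'C(s.-1, 2) *: f (X1 ++ M1 :: Z1)).
  rewrite /desuspend size_cat /= !size_map addnS /=; congr (_ *: _).
  rewrite twist_cat /= !size_map !twist_map // linearZ seq_multilinearZ //.
  congr (_ *: f (_ ++ _)); rewrite -!map_comp; apply: eq_map => x /=.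
  by rewrite addnC iterD -eps_al_iter /t; congr (eps _);
    elim: (size Z) => //= n ->.
rewrite !scalerA -!exprD; congr (_ *: _).
rewrite -signr_odd -[RHS]signr_odd; congr (_ ^+ _).
have -> : ((r + s + t).-1 = (r + t) + s.-1)%N by lia.
(* The mixed term satisfies [(r + t) (s - 1) + r + t s = r s + t + 2 t (s - 1)], so both exponents
   have the same parity. *)
rewrite (bin2D (r + t) s.-1); move: ('C(r + t, 2)) ('C(s.-1, 2)) => c1 c2.
rewrite (_ : _ + (r + t * s) = r * s + t + c1 + c2 + (t * s.-1).*2)%N; last by nia.
by rewrite [in RHS]oddD odd_double addbF.
Qed.

End Desuspension.

(** * The Koszul sign on homogeneous words *)

Section Koszul.
Variables (F : fieldType) (V : gvect F) (eps : {linear V -> V}).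
Hypothesis epsP : is_parity eps.

Lemma signz_sub2 (s : nat) (n : int) : (-1) ^ ((s%:Z - 2) * n) = ((-1) ^ n) ^+ s :> F.
Proof.
rewrite mulrC -exprz_exp.
have sn : (-1) ^ n != 0 :> F by rewrite expfz_neq0 // oppr_eq0 oner_eq0.
rewrite expfzDr // -[RHS]mulr1; congr (_ * _).
by rewrite -exprz_inv /exprz /= expr2 -invfM signz_sqr invr1.
Qed.

(** As [s] and [s - 2] have the same parity, applying [eps] to each letter [s] times realises the
    sign of moving [mu_s] past them. *)
Lemma koszul_sign (W : lmodType F) (f : seq V -> W) (s : nat) d l l' :
  seq_multilinear f -> homog d l ->
  f (map (iter s eps) l ++ l')
  = (-1) ^ ((s%:Z - 2) * \sum_(n <- d) n) *: f (l ++ l').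
Proof.
move=> fl; elim: l d f fl => [|x l IHl] [|n d] //= f fl.
  by rewrite big_nil mulr0 scale1r.
move=> /andP[xV dl].
have -> : iter s eps x = ((-1) ^ n) ^+ s *: x.
  elim: (s) => [|m IHm]; first by rewrite scale1r.
  by rewrite iterS IHm linearZ /= (epsP xV) scalerA -exprSr.
rewrite (seq_multilinearZ [::] _ _ _ fl) /= big_cons mulrDr expfzDr; last first.
  by rewrite oppr_eq0 oner_eq0.
rewrite -scalerA signz_sub2; congr (_ *: _).
exact: (IHl _ _ (seq_multilinear_cat [:: x] fl)).
Qed.

End Koszul.

(** * Passage between words and tuples *)

Lemma homog_map (F : fieldType) (V : gvect F) (u : V -> V) d l :
  has_degree 0 u -> homog d l -> homog d (map u l).
Proof.
move=> u0; elim: l d => [|x l IHl] [|n d] //= /andP[/u0 xV /IHl dl].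
by rewrite /homog /=; apply/andP; split => //; rewrite addr0 in xV.
Qed.

Lemma homog_tuple (F : fieldType) (V : gvect F) k (d : k.-tuple int) (t : k.-tuple V) :
  (forall j, tnth t j \in gpart V (tnth d j)) -> homog d t.
Proof.
elim: k d t => [|k IHk] d t dt; first by rewrite (tuple0 d) (tuple0 t).
move: d t dt => /tupleP[n d] /tupleP[x t] dt.
rewrite /homog /=; apply/andP; split; first by have := dt ord0; rewrite !tnth0.
by apply: IHk => j; have := dt (lift ord0 j); rewrite !tnthS.
Qed.

Lemma upd_tuple_seq (T : Type) k (t : k.-tuple T) (j : 'I_k) x :
  upd_tuple t j x = take j t ++ x :: drop j.+1 t :> seq T.
Proof.
apply: (@eq_from_nth _ x).
  by rewrite size_tuple size_cat /= size_takel ?size_drop size_tuple; case: j => /=; lia.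
move=> m; rewrite size_tuple => mk.
rewrite -(tnth_nth x _ (Ordinal mk)) tnth_mktuple nth_cat size_takel; last first.
  by rewrite size_tuple ltnW.
rewrite -val_eqE /=; case: ltngtP => [mj|jm|->]; last by rewrite subnn.
  by rewrite nth_take // (tnth_nth x).
rewrite -(subnSK jm) /= nth_drop addSn -addnS subnSK // subnKC ?(ltnW jm) //.
by rewrite (tnth_nth x).
Qed.

Lemma multilinear_in_seq (F : fieldType) (V W : lmodType F) (f : seq V -> W) k :
  seq_multilinear f -> multilinear (fun t : k.-tuple V => f t).
Proof. by move=> fl j t c x y; rewrite !upd_tuple_seq fl. Qed.

(** A composition [r + s + t = n] with [s > 0] is the choice of a nonempty factor from [r] to
    [e = r + s]. *)
Lemma sum_compositions (V : zmodType) n (G : nat -> nat -> nat -> V) :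
  \sum_(r < n.+1) \sum_(s < n.+1)
     \sum_(t < n.+1 | (r + s + t == n)%N && (0 < s)%N) G r s t =
  \sum_(0 <= r < n) \sum_(r.+1 <= e < n.+1) G r (e - r)%N (n - e)%N.
Proof.
pose E r := \sum_(r.+1 <= e < n.+1) G r (e - r)%N (n - e)%N.
transitivity (\sum_(0 <= r < n.+1) E r); last first.
  by rewrite big_nat_recr //= [X in _ + X]big_geq ?addr0.
rewrite big_mkord; apply: eq_bigr => r _; rewrite /E -(add1n r) big_addn.
rewrite (big_nat_widen _ _ n.+1) ?leq_subr // (big_nat_widenl _ 0%N) // big_mkord.
rewrite [RHS]big_mkcond; apply: eq_bigr => s _ /=.
case: ifP => rs; last by rewrite big_pred0 // => t; lia.
have tn : (n - (s + r) < n.+1)%N by lia.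
rewrite (big_pred1 (Ordinal tn)) ?addnK // => t.
by rewrite /= -val_eqE /=; lia.
Qed.

Lemma homog_twist (F : fieldType) (V : gvect F) (eps : {linear V -> V}) d l :
  has_degree 0 eps -> homog d l -> homog d (twist eps l).
Proof.
move=> eps0; elim: l d => [|x l IHl] [|n d] //= /andP[xV /IHl dl].
rewrite /homog /=; apply/andP; split => //.
by have := has_degree_iter (size l) eps0 xV; rewrite addr0.
Qed.

Lemma parity_bilinear (F : fieldType) (A : gvect F) (eps : {linear A -> A})
    (mu : {bilinear A -> A -> A}) :
  is_parity eps ->
  (forall (m n : int) (a b : A), a \in gpart A m -> b \in gpart A n ->
     mu a b \in gpart A (m + n)) ->
  forall a b, eps (mu a b) = mu (eps a) (eps b).
Proof.
move=> epsP mu0 a b; elim/gpart_ind: a => [|x y|m a aA].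
- by rewrite linear0 !linear0l linear0.
- by rewrite linearD !linearDl linearD => -> ->.
elim/gpart_ind: b => [|x y|n b bA].
- by rewrite !linear0.
- by rewrite !linearD => -> ->.
rewrite (epsP _ _ (mu0 _ _ _ _ aA bA)) (epsP _ _ aA) (epsP _ _ bA).
rewrite linearZl_LR linearZr_LR scalerA -expfzDr //.
by rewrite oppr_eq0 oner_eq0.
Qed.

(** * Assembly of the transferred structure *)

Theorem theorem3p13 (F : fieldType) (char0 : [pchar F] =i pred0)
    (A H : chain_complex F)
    (p : {linear A -> H}) (i : {linear H -> A}) (h : {linear A -> A})
    (contr : contraction p i h)
    (mu : {bilinear A -> A -> A}) (alpha : {linear A -> A})
    (alpha_neq0 : exists a : A, alpha a <> 0)
    (dgha : dg_hom_assoc mu alpha)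
    (alpha_h : forall a : A, alpha (h a) = h (alpha a)) :
  exists muH : forall k : nat, k.-tuple H -> H,
    [/\ is_HAinf muH (p \o alpha \o i),
        forall x : H, muH 1%N [tuple x] = cc_d H x
      & forall x y : H, muH 2%N [tuple x; y] = p (mu (i x) (i y))].
Proof.
case: contr => -[p0 p_d] [i0 i_d] h1 homotopy pi1.
case: dgha => mu0 [al0 [al_mu [hom_assoc [al_d d_mu]]]].
have [epsA epsAP] := parity_involution A.
have [epsH epsHP] := parity_involution H.
have epsA0 := parity_has_degree epsAP; have epsH0 := parity_has_degree epsHP.
(* By the homotopy identity, [i p] is [1 - d h - h d], and [alpha] commutes with [d] and [h]. With
   [p i = 1] this makes [i] and [p] intertwine [alpha] and [alH]. *)
have al_ip a : alpha (i (p a)) = i (p (alpha a)).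
  apply: oppr_inj; apply: (addrI (alpha a)).
  by rewrite homotopy -linearB homotopy linearD /= !(al_d, alpha_h).
pose alH : {linear H -> H} := p \o alpha \o i.
have al_i x : alpha (i x) = i (alH x) by rewrite /= -al_ip pi1.
have al_p a : alH (p a) = p (alpha a) by rewrite /= al_ip pi1.
have epsA_al a : epsA (alpha a) = alpha (epsA a).
  by rewrite (parity_commute epsAP epsAP al0) expr0z scale1r.
have epsA_h a : epsA (h a) = - h (epsA a).
  by rewrite (parity_commute epsAP epsAP h1) expr1z scaleN1r.
have epsA_d a : epsA (cc_d A a) = - cc_d A (epsA a).
  by rewrite (parity_commute epsAP epsAP (cc_degree (c := A))) exprN1 invrN1 scaleN1r.
have epsA_i x : epsA (i x) = i (epsH x).
  by rewrite (parity_commute epsHP epsAP i0) expr0z scale1r.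
have epsH_p a : epsH (p a) = p (epsA a).
  by rewrite (parity_commute epsAP epsHP p0) expr0z scale1r.
have epsH_d x : epsH (cc_d H x) = - cc_d H (epsH x).
  by rewrite (parity_commute epsHP epsHP (cc_degree (c := H))) exprN1 invrN1 scaleN1r.
have epsH_al x : epsH (alH x) = alH (epsH x).
  by rewrite /= epsH_p epsA_al epsA_i.
have epsA_mu := parity_bilinear epsAP mu0.
have alH_d x : alH (cc_d H x) = cc_d H (alH x).
  by rewrite /= i_d al_d p_d.
have d_smu a b : cc_d A (mu a b) = mu (cc_d A a) b + mu (epsA a) (cc_d A b).
  elim/gpart_ind: a => [|x y|n a aA].
  - by rewrite !linear0 !linear0l linear0 addr0.
  - by rewrite !linearD !linearDl linearD => -> ->; rewrite addrACA.
  by rewrite (d_mu n) // (epsAP _ _ aA) linearZl_LR.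
have dH_dH := @cc_dd _ H.
pose B := bmap p i h mu alpha epsA (cc_d H).
have B_multilinear : seq_multilinear B by exact: seq_multilinear_bmap.
have B_eps l : B (map (fun x => - epsH x) l) = epsH (B l) by exact: bmap_sigma.
have D_multilinear := seq_multilinear_desuspend epsH B_multilinear.
exists (fun k t => desuspend epsH B t).
split; [split; [| split; [| split; [| split; [| split]]]] | |].
- by move=> k _; exact: multilinear_in_seq.
- move=> k k_gt0 d t dt; apply: gpartZ.
  have := seq_degree_bmap mu0 p0 i0 h1 al0 epsA0 (cc_degree (c := H))
    (homog_twist epsH0 (homog_tuple dt)).
  by rewrite size_twist size_tuple big_tuple addrA.
- exact: linearP.
- move=> n x xH; have := p0 _ _ (al0 _ _ (i0 _ _ xH)).
  by rewrite !addr0.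
- move=> k t _; rewrite /desuspend size_map twist_map // -[LHS]/(alH _) linearZ.
  congr (_ *: _); exact: bmap_al.
- move=> n d a n_gt0 da; have {}da := homog_tuple da.
  rewrite [LHS](sum_compositions n (fun r s t => (-1) ^+ (r * s + t) *:
    ha_comp (fun k (t : k.-tuple H) => desuspend epsH B t) alH r s d a)).
  (* All terms share one sign depending only on [n], so the relation reduces to [stasheff] on the
     twisted word. *)
  transitivity ((-1) ^+ 'C(n.-1, 2) *:
      coder B (fun x => - epsH x) alH B (twist epsH a)); last first.
    by rewrite (stasheff (dA := cc_d A)) ?scaler0.
  rewrite /coder size_twist size_tuple scaler_sumr; apply: eq_big_nat => r rn.
  rewrite scaler_sumr; apply: eq_big_nat => e re.
  pose X := take r a; pose M := drop r (take e a); pose Z := drop e a.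
  have sizeX : size X = r by rewrite size_takel // size_tuple; lia.
  have sizeM : size M = (e - r)%N by rewrite size_drop size_takel // size_tuple; lia.
  have sizeZ : size Z = (n - e)%N by rewrite size_drop size_tuple.
  have aE : X ++ M ++ Z = a.
    have -> : X = take r (take e a) by rewrite take_takel //; lia.
    by rewrite catA !cat_take_drop.
  have := desuspend_insert epsH_al B_multilinear B_eps X Z (M := M).
  rewrite aE sizeX sizeM sizeZ.
  have -> : (r + (e - r) + (n - e) = n)%N by lia.
  have -> : (r + (e - r) = e)%N by lia.
  move=> <-; last by lia.
  congr (_ *: _).
  rewrite /ha_comp take_drop subnK; last by lia.
  rewrite subnKC; last by lia.
  have alH0 : has_degree 0 alH.
    by move=> m x xH; have := p0 _ _ (al0 _ _ (i0 _ _ xH)); rewrite !addr0.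
  (* The explicit Koszul sign of [ha_comp] is absorbed into powers of [epsH] on the first [r]
     letters. *)
  rewrite -(koszul_sign epsHP _ _ D_multilinear
    (homog_map (has_degree_iter (e - r).-1 alH0) (homog_take r da))).
  congr (desuspend epsH B (_ ++ _)); rewrite -!map_comp; apply: eq_map => x /=.
  have alH_eps m y : epsH (iter m alH y) = iter m alH (epsH y) by exact: iter_morph.
  by rewrite -(iter_morph _ (fun y => esym (alH_eps (e - r).-1 y))).
- move=> x; rewrite /desuspend /= bin0n scale1r /B /bmap /lam /cup.
  by rewrite big_geq // linear0 addr0.
(* In arity two there is a single cut; the [epsH] of the twist on [x] cancels the [epsA] of the
   shifted product. *)
- move=> x y; rewrite /desuspend /= scale1r /B /bmap /lam /cup /= add0r big_nat1 /=.
  rewrite !phiE /lam /cup /= !big_geq // linear0 !subr0 /smu.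
  by rewrite epsA_i (parityK epsHP).
Qed.
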